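(* Let $a>0$ and $L_0<\lambda^G_{\pi,\nu}<U_0$ be reals. Define, for $k=0,1,2,\dots$, $\lambda_k=\tfrac12(L_k+U_k)$, the function $\psi_k:V\to\mathbb{R}$ by $$\psi_k(1)=-a,\qquad \psi_k(i+1)=\psi_k(i)+\frac{\{[\psi_k(i)-\psi_k(i-1)]\nu(i-1,i)-\lambda_k\pi(i)\psi_k(i)\}^+}{\nu(i,i+1)}\quad(1\le i<n),$$ and $$\begin{cases}L_{k+1}=L_k,\ U_{k+1}=\lambda_k&\text{if }\pi(\psi_k)>0,\\ L_{k+1}=\lambda_k,\ U_{k+1}=U_k&\text{if }\pi(\psi_k)<0,\\ L_{k+1}=U_{k+1}=\lambda_k&\text{if }\pi(\psi_k)=0.\end{cases}$$ Then $$0\le\max\{U_k-\lambda^G_{\pi,\nu},\ \lambda^G_{\pi,\nu}-L_k\}\le(U_0-L_0)2^{-k},\qquad\forall k\ge0.$$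
   Context: Let $n\ge2$, $V=\{1,\dots,n\}$, $E=\{\{i,i+1\}:1\le i\le n-1\}$ and $G=(V,E)$. Let $\pi$ be a positive measure on $V$ with $\pi(V)=\sum_{i}\pi(i)=1$ and $\nu$ a positive measure on $E$ (write $\nu(i,i+1)=\nu(i+1,i)>0$), with the convention $\nu(0,1)=\nu(n,n+1)=0$ (so terms multiplied by these coefficients vanish). For functions $f,g$ on $V$ put $\pi(f)=\sum_i f(i)\pi(i)$, $\mathcal{E}_\nu(f,g)=\sum_{i=1}^{n-1}[f(i)-f(i+1)][g(i)-g(i+1)]\nu(i,i+1)$ and $\mathrm{Var}_\pi(f)=\pi(f^2)-\pi(f)^2$. The spectral gap is $\lambda^G_{\pi,\nu}=\min\{\mathcal{E}_\nu(f,f)/\mathrm{Var}_\pi(f): f \text{ non-constant}\}$. Notation: $t^+=\max\{t,0\}$. *)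

(* Defs.v *)
From mathcomp Require Import all_boot all_order all_algebra.
From mathcomp Require Import boolp classical_sets reals.
From mathcomp Require Import topology normedtype derive.
From mathcomp Require Import ring lra.

Set Implicit Arguments.
Unset Strict Implicit.
Unset Printing Implicit Defensive.

Import Order.TTheory GRing.Theory Num.Theory.
Import numFieldNormedType.Exports.

Local Open Scope classical_set_scope.
Local Open Scope ring_scope.

(* The vertex set V = {1, ..., n} is encoded by 'I_n and the edge set E of the
   path by 'I_n.-1: the ordinal j stands for the vertex j + 1, respectively for
   the edge {j + 1, j + 2}.  [at1 f k] reads off the value of f at the 1-based
   index k, so that [at1 f i] is f(i) for a vertex i, and [at1 nu i] is
   nu(i, i+1) = nu(i+1, i) for an edge {i, i+1}.  Outside the index range its
   value is 0, which is the convention nu(0, 1) = nu(n, n+1) = 0. *)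
Definition at1 (R : realType) (m : nat) (f : 'I_m -> R) (k : nat) : R :=
  if k is j.+1 then oapp f 0 (insub j) else 0.

Definition mean (R : realType) (n : nat) (pi f : 'I_n -> R) : R :=
  \sum_(i < n) f i * pi i.

Definition energy (R : realType) (n : nat) (nu : 'I_n.-1 -> R)
    (f g : 'I_n -> R) : R :=
  \sum_(1 <= i < n)
    (at1 f i - at1 f i.+1) * (at1 g i - at1 g i.+1) * at1 nu i.

Definition variance (R : realType) (n : nat) (pi f : 'I_n -> R) : R :=
  mean pi (fun i => f i ^+ 2) - mean pi f ^+ 2.

Definition nonconstant (R : realType) (n : nat) (f : 'I_n -> R) : Prop :=
  exists i j : 'I_n, f i <> f j.

Definition rayleigh_quotients (R : realType) (n : nat) (pi : 'I_n -> R)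
    (nu : 'I_n.-1 -> R) : set R :=
  [set energy nu f f / variance pi f | f in [set f | nonconstant f]].

(* This infimum is a minimum, see [spectral_gap_min] below. *)
Definition spectral_gap (R : realType) (n : nat) (pi : 'I_n -> R)
    (nu : 'I_n.-1 -> R) : R :=
  inf (rayleigh_quotients pi nu).

(* The shooting recursion with parameter lam, as a function of the 1-based
   vertex.  The value at 0 is immaterial, since it is only used multiplied by
   nu(0, 1) = 0; so are the values beyond n. *)
Fixpoint psi_at (R : realType) (n : nat) (pi : 'I_n -> R)
    (nu : 'I_n.-1 -> R) (a lam : R) (k : nat) : R :=
  if k is i.+1 then
    if i is h.+1 then
      psi_at pi nu a lam i
      + Num.max ((psi_at pi nu a lam i - psi_at pi nu a lam h) * at1 nu h
                 - lam * at1 pi i * psi_at pi nu a lam i) 0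
        / at1 nu i
    else - a
  else 0.

Definition psi (R : realType) (n : nat) (pi : 'I_n -> R)
    (nu : 'I_n.-1 -> R) (a lam : R) (i : 'I_n) : R :=
  psi_at pi nu a lam i.+1.

(* The pair (L_k, U_k). *)
Fixpoint bisection (R : realType) (n : nat) (pi : 'I_n -> R)
    (nu : 'I_n.-1 -> R) (a L0 U0 : R) (k : nat) : R * R :=
  if k is j.+1 then
    let: (L, U) := bisection pi nu a L0 U0 j in
    let lam := (L + U) / 2 in
    let m := mean pi (psi pi nu a lam) in
    if 0 < m then (L, lam) else if m < 0 then (lam, U) else (lam, lam)
  else (L0, U0).

Definition lower (R : realType) (n : nat) (pi : 'I_n -> R)
    (nu : 'I_n.-1 -> R) (a L0 U0 : R) (k : nat) : R :=
  (bisection pi nu a L0 U0 k).1.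

Definition upper (R : realType) (n : nat) (pi : 'I_n -> R)
    (nu : 'I_n.-1 -> R) (a L0 U0 : R) (k : nat) : R :=
  (bisection pi nu a L0 U0 k).2.

Lemma mean_affine (R : realType) (n : nat) (pi f : 'I_n -> R) (c m : R) :
  \sum_(i < n) pi i = 1 ->
  mean pi (fun i => c * (f i - m)) = c * (mean pi f - m).
Proof.
move=> pi1; rewrite /mean; under eq_bigr do rewrite -mulrA mulrBl.
by rewrite -mulr_sumr sumrB -mulr_sumr pi1 mulr1.
Qed.

Lemma varianceE (R : realType) (n : nat) (pi f : 'I_n -> R) :
  \sum_(i < n) pi i = 1 ->
  variance pi f = mean pi (fun i => (f i - mean pi f) ^+ 2).
Proof.
move=> pi1; set m := mean pi f.
have -> : mean pi (fun i => (f i - m) ^+ 2) =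
    \sum_(i < n) (f i ^+ 2 * pi i - (2 * m) * (f i * pi i) + m ^+ 2 * pi i).
  by apply: eq_bigr => i _; ring.
rewrite big_split/= sumrB -!mulr_sumr pi1 -/(mean pi f) -/m /variance -/m.
rewrite /mean; ring.
Qed.

Lemma variance_gt0 (R : realType) (n : nat) (pi f : 'I_n -> R) :
  (forall i, 0 < pi i) -> \sum_(i < n) pi i = 1 -> nonconstant f ->
  0 < variance pi f.
Proof.
move=> pi0 pi1 [i [j fij]]; rewrite varianceE// lt_neqAle.
have ge0 k : true -> 0 <= (f k - mean pi f) ^+ 2 * pi k.
  by move=> _; rewrite mulr_ge0 ?sqr_ge0 ?ltW.
rewrite sumr_ge0// andbT eq_sym; apply/negP => /eqP /psumr_eq0P E.
have h k : f k = mean pi f.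
  have /eqP := E ge0 k isT.
  by rewrite mulf_eq0 sqrf_eq0 (gt_eqF (pi0 k)) orbF subr_eq0 => /eqP.
by apply: fij; rewrite !h.
Qed.

Lemma at1_affine (R : realType) (m : nat) (f : 'I_m -> R) (c d : R) (k : nat) :
  (0 < k <= m)%N -> at1 (fun i => c * (f i - d)) k = c * (at1 f k - d).
Proof. by case: k => // k km; rewrite /= insubT. Qed.

Lemma energy_affine (R : realType) (n : nat) (nu : 'I_n.-1 -> R)
    (f : 'I_n -> R) (c d : R) :
  energy nu (fun i => c * (f i - d)) (fun i => c * (f i - d)) =
  c ^+ 2 * energy nu f f.
Proof.
rewrite /energy mulr_sumr; apply: eq_big_nat => i /andP[i1 iltn].
by rewrite !at1_affine ?i1 ?(ltnW iltn) //; ring.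
Qed.

Lemma spectral_gap_min (R : realType) (n : nat) (pi : 'I_n -> R)
    (nu : 'I_n.-1 -> R) :
  (2 <= n)%N -> (forall i, 0 < pi i) -> \sum_(i < n) pi i = 1 ->
  rayleigh_quotients pi nu (spectral_gap pi nu) /\
  lbound (rayleigh_quotients pi nu) (spectral_gap pi nu).
Proof.
move=> n2 pi0 pi1.
pose ev (v : 'rV[R]_n) i := v ord0 i.
have evC i : continuous (ev^~ i) by exact: coord_continuous.
have sumC (I : Type) (r : seq I) (F : I -> 'rV[R]_n -> R) :
    (forall i, continuous (F i)) -> continuous (fun v => \sum_(i <- r) F i v).
  by move=> FC; apply: continuous_big => //; exact: add_continuous.
have atC k : continuous (fun v => at1 (ev v) k).
  case: k => [|k] /=; first exact: cst_continuous.
  by case: insubP => [i _ _|_] /=; [exact: evC|exact: cst_continuous].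
have mulC (T : topologicalType) (f g : T -> R) :
    continuous f -> continuous g -> continuous (fun x => f x * g x).
  by move=> fC gC x; exact: cvgM (fC x) (gC x).
have subC (T : topologicalType) (f g : T -> R) :
    continuous f -> continuous g -> continuous (fun x => f x - g x).
  by move=> fC gC x; exact: cvgB (fC x) (gC x).
have energyC : continuous (fun v => energy nu (ev v) (ev v)).
  apply: sumC => i; apply: (mulC _ _ (fun=> at1 nu i)); last first.
    exact: cst_continuous.
  by apply: mulC; apply: subC; exact: atC.
have meanC : continuous (fun v => mean pi (ev v)).
  apply: sumC => i; apply: (mulC _ _ (fun=> pi i)); first exact: evC.
  exact: cst_continuous.
have mean2C : continuous (fun v => mean pi (fun i => ev v i ^+ 2)).
  apply: sumC => i; apply: (mulC _ _ (fun=> pi i)); last exact: cst_continuous.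
  by apply: mulC; exact: evC.
pose K := [set v | mean pi (ev v) = 0] `&`
          [set v | mean pi (fun i => ev v i ^+ 2) = 1].
have Kclosed : closed K.
  apply: closedI.
    by apply: (@preimage_closed _ _ (fun v => mean pi (ev v)) [set x | x = 0]).
  by apply: (@preimage_closed _ _
    (fun v => mean pi (fun i => ev v i ^+ 2)) [set x | x = 1]).
have Kbounded : bounded_set K.
  exists (\sum_(i < n) (1 + (pi i)^-1)); split; first exact: num_real.
  move=> M /ltW ltM v [_ v1].
  have M0 : 0 <= \sum_(i < n) (1 + (pi i)^-1).
    by rewrite sumr_ge0// => i _; rewrite addr_ge0// invr_ge0 ltW.
  move=> /=; rewrite [leLHS]/Num.norm /= mx_normrE; apply/bigmax_leP; split=> [|[i j] _ /=].
    exact: le_trans ltM.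
  rewrite (ord1 i); apply: le_trans ltM.
  rewrite (bigD1 j)//=; apply: ler_wpDr.
    by rewrite sumr_ge0// => k _; rewrite addr_ge0// invr_ge0 ltW.
  have : ev v j ^+ 2 * pi j <= 1.
    rewrite -v1 /mean (bigD1 j)//= lerDl sumr_ge0// => k _.
    by rewrite mulr_ge0 ?sqr_ge0 ?ltW.
  rewrite -ler_pdivlMr// mul1r => h.
  have h2 : `|v ord0 j| ^+ 2 <= (pi j)^-1 by rewrite real_normK ?num_real.
  have := sqr_ge0 (`|v ord0 j| - 1); have := normr_ge0 (v ord0 j); nra.
have normalize f : nonconstant f ->
    exists2 v, K v & energy nu (ev v) (ev v) = energy nu f f / variance pi f.
  move=> fnc; have s0 := variance_gt0 pi0 pi1 fnc.
  pose c := (Num.sqrt (variance pi f))^-1.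
  have c2 : c ^+ 2 = (variance pi f)^-1 by rewrite exprVn sqr_sqrtr// ltW.
  pose v : 'rV[R]_n := \row_i (c * (f i - mean pi f)).
  have evv : ev v = fun i => c * (f i - mean pi f).
    by apply/funext => i; rewrite /ev mxE.
  exists v; last by rewrite evv energy_affine c2 mulrC.
  split; rewrite /= evv; first by rewrite mean_affine// subrr mulr0.
  transitivity (c ^+ 2 * variance pi f); last by rewrite c2 mulVf// gt_eqF.
  rewrite varianceE// mulr_sumr; apply: eq_bigr => i _; ring.
have [w Kw] : K !=set0.
  pose f (i : 'I_n) : R := (val i == 0%N)%:R.
  have [v Kv _] : exists2 v, K v &
      energy nu (ev v) (ev v) = energy nu f f / variance pi f.
    apply: normalize; exists (Ordinal (ltnW n2)), (Ordinal n2).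
    by rewrite /f /=; apply/eqP; rewrite oner_eq0.
  by exists v.
have [v] := compact_EVT_min (ex_intro _ w Kw)
  (bounded_closed_compact Kbounded Kclosed) (continuous_subspaceT energyC).
rewrite inE => Kv vmin.
have lb : lbound (rayleigh_quotients pi nu) (energy nu (ev v) (ev v)).
  move=> _ [f fnc <-]; have [u Ku <-] := normalize f fnc.
  by apply: vmin; rewrite inE.
have var1 : variance pi (ev v) = 1.
  by case: Kv => /= m0 m1; rewrite /variance m0 m1 expr0n subr0.
have vnc : nonconstant (ev v).
  apply: contrapT => vc.
  have vE i j : ev v i = ev v j.
    by apply: contrapT => ne; apply: vc; exists i, j.
  have meanE : mean pi (ev v) = ev v (Ordinal n2).
    rewrite -[RHS]mulr1 -pi1 mulr_sumr; apply: eq_bigr => i _.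
    by rewrite (vE i (Ordinal n2)).
  have : variance pi (ev v) = 0.
    rewrite varianceE// /mean big1// => i _.
    by rewrite -/(mean pi (ev v)) meanE (vE i (Ordinal n2)) subrr expr0n mul0r.
  by rewrite var1 => /eqP; rewrite oner_eq0.
have vin : rayleigh_quotients pi nu (energy nu (ev v) (ev v)).
  by exists (ev v) => //; rewrite var1 divr1.
suff -> : spectral_gap pi nu = energy nu (ev v) (ev v) by [].
apply/eqP; rewrite eq_le; apply/andP; split.
  by apply: ge_inf => //; exists (energy nu (ev v) (ev v)).
by apply: lb_le_inf => //; exists (energy nu (ev v) (ev v)).
Qed.

(* Main.v *)
Require Import Defs.
From mathcomp Require Import all_boot all_order all_algebra.
From mathcomp Require Import boolp classical_sets reals.
From mathcomp Require Import ring lra.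

(** Each step of the bisection halves its interval or reduces it to a point, so everything rests on the fact
that the sign of the mean of [psi] with parameter [t] locates [t] with respect
to the spectral gap [g]:
- [le_spectral_gap]: if the mean is nonpositive, then [t <= g];
- [spectral_gap_le]: if the mean is nonnegative, then [g <= t].
Together they cover the three branches of the bisection, a zero mean giving
[t = g].

Let [d i] be the flux into vertex [i] from its left neighbour, that is
[nu(i-1, i) * (psi(i) - psi(i-1))]. The recursion reads
[d (i+1) = max (d i - t * pi(i) * psi(i)) 0], and it is extended by one step
past the last vertex to define an exit flux. For [t <= 0] the flux vanishes and
[psi] is constant equal to [- a]. For [0 < t] the flux can only stop at a vertex
where [psi] is positive, and from then on [psi] is constant; as long as the
flux runs, it equals [- t] times the partial sum of [pi * psi]. The sign of the
mean thus tells whether and where the truncation takes place.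

Let [0 < t]. If the mean is nonpositive, the flux is positive on every edge, and it is a
positive supersolution of the eigenvalue problem dual to the spectral gap,
which lives on edges and has zero boundary values. A supersolution of this kind
yields a Hardy inequality for the partial sums of [pi * f] when [f] has mean
zero ([hardy_of_shooting]), and duality turns it into the Poincare inequality
[t * variance f <= energy f] ([poincare_of_shooting]).

If the mean is nonnegative, the exit flux is zero, and [psi] itself is a test
function with Rayleigh quotient at most [t] ([energy_le_of_shooting]). Where
the flux is not truncated, [psi] solves the eigenvalue equation exactly; where
it is truncated, [psi] has reached its maximum, hence is at least its mean, and
the truncation error has the favourable sign. *)

Set Implicit Arguments.
Unset Strict Implicit.

Import Order.TTheory GRing.Theory Num.Theory.

Local Open Scope ring_scope.

(** * The shooting recursion and its flux *)

Lemma sum_by_parts (R : comPzRingType) (x g : nat -> R) (m : nat) :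
  \sum_(i < m.+1) x i * (g i.+1 - g i) =
  x m * g m.+1 - x 0 * g 0 - \sum_(i < m) (x i.+1 - x i) * g i.+1.
Proof.
elim: m => [|m IH]; first by rewrite big_ord1 big_ord0 /=; ring.
by rewrite big_ord_recr /= IH [in RHS]big_ord_recr /=; ring.
Qed.

(** Vertices are [0, ..., m] and [v i] is the weight of the edge [{i, i+1}], so
that [d i.+1] is the flux through that edge. The flux equation is also imposed
at the last vertex: the exit flux [d m.+1] records the sign of the mean. *)
Record shooting (R : realFieldType) (m : nat) (p v : nat -> R) (a t : R)
    (y d : nat -> R) : Prop := Shooting {
  shooting_start : y 0%N = - a;
  shooting_flux0 : d 0%N = 0;
  shooting_fluxS : forall i, (i <= m)%N ->
    d i.+1 = Num.max (d i - t * p i * y i) 0;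
  shooting_step : forall i, (i < m)%N -> y i.+1 = y i + d i.+1 / v i }.


Section Shooting.
Context {R : realFieldType} {m : nat} {p v : nat -> R} {a t : R}.
Context {y d : nat -> R}.
Hypothesis yd : shooting m p v a t y d.
Hypothesis p_gt0 : forall i, (i <= m)%N -> 0 < p i.
Hypothesis v_gt0 : forall i, (i < m)%N -> 0 < v i.
Hypothesis a_gt0 : 0 < a.

Lemma flux_ge i : (i <= m)%N -> d i - t * p i * y i <= d i.+1.
Proof. by move=> im; rewrite (shooting_fluxS yd im) le_max lexx. Qed.

Lemma flux_eq i : (i <= m)%N -> 0 < d i.+1 ->
  d i.+1 = d i - t * p i * y i.
Proof.
move=> im; rewrite (shooting_fluxS yd im).
by case: (leP (d i - t * p i * y i) 0) => //; rewrite ltxx.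
Qed.

Lemma flux_ge0 i : (i <= m.+1)%N -> 0 <= d i.
Proof.
case: i => [|i] im; first by rewrite (shooting_flux0 yd).
by rewrite (shooting_fluxS yd im) le_max lexx orbT.
Qed.

Lemma flux_eq0 i : (i <= m)%N -> d i.+1 <= 0 -> d i.+1 = 0.
Proof. by move=> im di; apply/eqP; rewrite eq_le di flux_ge0. Qed.

Lemma shooting_mono i j : (i <= j)%N -> (j <= m)%N -> y i <= y j.
Proof.
elim: j => [|j IH]; first by rewrite leqn0 => /eqP ->.
rewrite leq_eqVlt => /predU1P[-> //|]; rewrite ltnS => ij jm.
apply: (le_trans (IH ij (ltnW jm))).
by rewrite (shooting_step yd jm) lerDl divr_ge0 ?flux_ge0 ?ltW ?v_gt0 // ltnW.
Qed.

Lemma shooting_nonpos i : t <= 0 -> (i <= m)%N -> y i = - a /\ d i = 0.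
Proof.
move=> t0; elim: i => [|i IH] im.
  by rewrite (shooting_start yd) (shooting_flux0 yd).
have [yi di] := IH (ltnW im).
have dS : d i.+1 = 0.
  rewrite (shooting_fluxS yd (ltnW im)) yi di; apply/max_idPr.
  have tp := mulr_le0_ge0 t0 (ltW (p_gt0 (ltnW im))).
  by have := mulr_le0_ge0 tp (ltW a_gt0); lra.
by rewrite (shooting_step yd im) dS mul0r addr0.
Qed.

(** The truncation at zero can only increase the flux. *)
Lemma flux_ge_sum k : (k <= m.+1)%N -> - t * \sum_(i < k) p i * y i <= d k.
Proof.
elim: k => [|k IH] km; first by rewrite big_ord0 mulr0 (shooting_flux0 yd).
apply: le_trans (flux_ge km); rewrite big_ord_recr /= mulrDr mulNr.
by have := IH (ltnW km); rewrite mulNr; lra.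
Qed.

Hypothesis t_gt0 : 0 < t.

(** The flux starts at [t * p 0 * a > 0]. Where it first stops, the untruncated
value [d i - t * p i * y i] is nonpositive although [d i] is positive, which
forces [y i] to be positive; later values of [y] are the same. *)
Lemma shooting_gt0 i : (i <= m)%N -> d i.+1 = 0 -> 0 < y i.
Proof.
elim: i => [|i IH] im dS; have := flux_ge im; rewrite dS => le0;
    have tp := mulr_gt0 t_gt0 (p_gt0 im).
  move: le0; rewrite (shooting_flux0 yd) (shooting_start yd).
  by have := mulr_gt0 tp a_gt0; lra.
have [di|di] := leP (d i.+1) 0.
  have di0 := flux_eq0 (ltnW im) di.
  by rewrite (shooting_step yd im) di0 mul0r addr0 IH // ltnW.
by rewrite -(pmulr_rgt0 _ tp); lra.
Qed.

(** Once stopped at a positive value, the profile has no incoming flux and a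
positive value to subtract, so the truncation is active at all later vertices. *)
Lemma shooting_stop i j : (i <= j)%N -> (j <= m)%N -> d i.+1 = 0 ->
  d j.+1 = 0 /\ y j = y i.
Proof.
move=> + + dS; elim: j => [|j IH]; first by rewrite leqn0 => /eqP <-.
rewrite leq_eqVlt => /predU1P[<- //|]; rewrite ltnS => ij jm.
have [dj yj] := IH ij (ltnW jm).
have yS : y j.+1 = y i by rewrite (shooting_step yd jm) dj mul0r addr0.
split=> //; rewrite (shooting_fluxS yd jm) dj yS; apply/max_idPr.
have := shooting_gt0 (leq_trans ij (ltnW jm)) dS.
by move=> /(mulr_gt0 (mulr_gt0 t_gt0 (p_gt0 jm))); lra.
Qed.

Lemma flux_gt0_down i j : (i <= j)%N -> (j <= m)%N -> 0 < d j.+1 -> 0 < d i.+1.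
Proof.
move=> ij jm dj; rewrite ltNge; apply/negP => di.
have im := leq_trans ij jm.
by have [dj0 _] := shooting_stop ij jm (flux_eq0 im di); move: dj; rewrite dj0 ltxx.
Qed.

Lemma flux_eq_sum k : (k <= m)%N -> 0 < d k.+1 ->
  d k.+1 = - t * \sum_(i < k.+1) p i * y i.
Proof.
elim: k => [|k IH] km dk; rewrite (flux_eq km dk).
  by rewrite big_ord1 (shooting_flux0 yd); ring.
rewrite IH ?(ltnW km) //; last exact: (flux_gt0_down (leqnSn k)).
by rewrite [in RHS]big_ord_recr /=; ring.
Qed.

(** If the flux stopped at [i < m], the partial sum of [p * y] up to [i] would be
nonnegative by [flux_ge_sum], and the vertices beyond [i], of which there is at
least one, would add positive terms. *)
Lemma flux_gt0_of_mean i : \sum_(i < m.+1) p i * y i <= 0 -> (i < m)%N ->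
  0 < d i.+1.
Proof.
move=> mean0 im; rewrite ltNge; apply/negP => di.
have dS := flux_eq0 (ltnW im) di.
have yi := shooting_gt0 (ltnW im) dS.
move: mean0; apply/negP; rewrite -ltNge.
have : forall k, (k < m.+1)%N -> (i < k)%N -> 0 < \sum_(j < k.+1) p j * y j.
  have s0 : 0 <= \sum_(j < i.+1) p j * y j.
    by have := @flux_ge_sum i.+1 (ltnW im); rewrite dS mulNr oppr_le0 pmulr_rge0.
  have term k : (i <= k)%N -> (k <= m)%N -> 0 < p k * y k.
    by move=> ik km; rewrite mulr_gt0 ?p_gt0 //;
       have [_ ->] := shooting_stop ik km dS.
  elim=> // k IH km ik; rewrite big_ord_recr /=.
  have tk := term _ (ltnW ik) km.
  move: ik; rewrite ltnS leq_eqVlt => /predU1P[ik|ik].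
    by rewrite -ik in tk *; rewrite ltr_wpDl.
  by rewrite addr_gt0 // IH // ltnW.
by apply.
Qed.

(** * Poincare inequality from a positive flux *)

(** Barta's argument on edges: write [h k] for the partial sums of [p * f]. By
convexity, [(h' - h)^2 >= (d' - d) * (h'^2 / d' - h^2 / d)] whenever
[d, d' > 0]; the flux equation replaces [d' - d] by [- t * p * y], and
summation by parts moves the difference onto [y], whose increments are [d / v]. *)
Lemma hardy_of_shooting (f : nat -> R) :
  \sum_(i < m.+1) p i * y i <= 0 -> \sum_(i < m.+1) p i * f i = 0 ->
  t * \sum_(i < m) (\sum_(j < i.+1) p j * f j) ^+ 2 / v i <=
  \sum_(i < m.+1) p i * f i ^+ 2.
Proof.
move=> mean0 f0; pose h k := \sum_(j < k) p j * f j.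
have hS i : h i.+1 = h i + p i * f i by rewrite /h big_ord_recr.
have dpos := fun i => @flux_gt0_of_mean i mean0.
pose q k := h k ^+ 2 / d k.
(* [q] vanishes at both ends because [h] does, even where [d] is zero. *)
have q0 : q 0%N = 0 by rewrite /q /h big_ord0 expr0n mul0r.
have qm : q m.+1 = 0 by rewrite /q /h f0 expr0n mul0r.
have -> : t * \sum_(i < m) (\sum_(j < i.+1) p j * f j) ^+ 2 / v i =
    \sum_(i < m.+1) - t * (y i * (q i.+1 - q i)).
  rewrite -mulr_sumr sum_by_parts q0 qm !mulr0 subr0 sub0r mulrNN; congr (_ * _).
  apply: eq_bigr => i _; rewrite (shooting_step yd) // -/(h i.+1) /q.
  have := dpos i (ltn_ord i); have := v_gt0 (ltn_ord i) => vi di.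
  by field; rewrite !gt_eqF.
apply: ler_sum => -[i /= im] _.
have pi0 := p_gt0 im; rewrite -(ler_pM2l pi0).
have -> : p i * (p i * f i ^+ 2) = (h i.+1 - h i) ^+ 2 by rewrite hS; ring.
have -> : p i * (- t * (y i * (q i.+1 - q i))) =
  - (t * p i * y i) * (q i.+1 - q i) by ring.
have hq k : (k <= m)%N -> h k ^+ 2 = q k * d k.
  case: k => [|k] km; first by rewrite /q /h big_ord0 expr0n !mul0r.
  by rewrite /q divfK // gt_eqF // dpos.
move: im; rewrite ltnS leq_eqVlt => /predU1P[ei|im].
  rewrite ei in pi0 *.
  have qi0 : 0 <= q m by rewrite divr_ge0 ?sqr_ge0 // flux_ge0.
  rewrite qm {1}/h f0 !sub0r sqrrN mulrNN hq // mulrC ler_wpM2l //.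
  (* At the last vertex the flux equation becomes the inequality
     [t * p m * y m <= d m], which says that the mean is nonpositive. *)
  have dm : d m = - t * \sum_(j < m) p j * y j.
    case: m flux_eq_sum dpos => [|k] fe dp.
      by rewrite big_ord0 mulr0 (shooting_flux0 yd).
    by apply: fe => //; apply: dp.
  move: mean0; rewrite big_ord_recr /= dm => mean0.
  by have := mulr_ge0_le0 (ltW t_gt0) mean0; lra.
have eD := flux_eq (ltnW im : (i <= m)%N) (dpos i im).
have -> : - (t * p i * y i) = d i.+1 - d i by rewrite eD; ring.
rewrite -subr_ge0; case: i im {eD pi0} => [|i] im.
  rewrite q0 (shooting_flux0 yd) !subr0 {1 2}/h big_ord0 subr0.
  by rewrite mulrC -hq ?subrr // ltnW.
have d1 := dpos _ im; have d0 := dpos _ (ltnW im).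
have -> : (h i.+2 - h i.+1) ^+ 2 - (d i.+2 - d i.+1) * (q i.+2 - q i.+1) =
  (h i.+2 * d i.+1 - h i.+1 * d i.+2) ^+ 2 / (d i.+2 * d i.+1).
  by rewrite /q; field; rewrite !gt_eqF.
by rewrite divr_ge0 ?sqr_ge0 // ltW // mulr_gt0.
Qed.

(** Duality between vertices and edges: summing by parts,
[W = \sum p f^2 = - \sum (f' - f) h], and [2 x y <= x^2 v + y^2 / v] with
[y = t h] gives [2 t W <= E + t^2 H], where [t H <= W] is the Hardy
inequality. *)
Lemma poincare_of_shooting (f : nat -> R) :
  \sum_(i < m.+1) p i * y i <= 0 -> \sum_(i < m.+1) p i * f i = 0 ->
  t * \sum_(i < m.+1) p i * f i ^+ 2 <=
  \sum_(i < m) (f i.+1 - f i) ^+ 2 * v i.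
Proof.
move=> mean0 f0; have := hardy_of_shooting mean0 f0.
pose h k := \sum_(j < k) p j * f j.
set H := \sum_(i < m) _; set W := \sum_(i < m.+1) _; set E := \sum_(i < m) _.
have WE : W = - \sum_(i < m) (f i.+1 - f i) * h i.+1.
  transitivity (\sum_(i < m.+1) f i * (h i.+1 - h i)).
    by apply: eq_bigr => i _; rewrite /h big_ord_recr /=; ring.
  by rewrite sum_by_parts {1 2}/h f0 big_ord0 !mulr0 subr0 sub0r.
have : 2 * t * W <= E + t ^+ 2 * H.
  rewrite WE mulrN -mulNr !mulr_sumr -big_split /=; apply: ler_sum => i _.
  rewrite -/(h i.+1) -subr_ge0; have vi := v_gt0 (ltn_ord i).
  have -> : (f i.+1 - f i) ^+ 2 * v i + t ^+ 2 * (h i.+1 ^+ 2 / v i) -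
      - (2 * t) * ((f i.+1 - f i) * h i.+1) =
    ((f i.+1 - f i) * v i + t * h i.+1) ^+ 2 / v i.
    by field; rewrite gt_eqF.
  by rewrite divr_ge0 ?sqr_ge0 // ltW.
by move=> AM; rewrite -(ler_pM2l t_gt0); nra.
Qed.

(** * The shooting profile as a test function *)

(** After summation by parts both sides are sums over vertices and are compared
term by term. Subtracting the mean [c] costs nothing on the left, since the
total change of the flux is zero. *)
Lemma energy_le_of_shooting (c : R) :
  c = \sum_(i < m.+1) p i * y i -> \sum_(i < m.+1) p i = 1 -> 0 <= c ->
  \sum_(i < m) (y i.+1 - y i) ^+ 2 * v i <=
  t * \sum_(i < m.+1) p i * (y i - c) ^+ 2.
Proof.
move=> cE p1 c0.
have dm : d m.+1 = 0.
  apply: flux_eq0 => //; rewrite leNgt; apply/negP => dm.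
  move: (dm); rewrite flux_eq_sum // -cE mulNr oppr_gt0 => tc.
  by have := mulr_ge0 (ltW t_gt0) c0; rewrite leNgt tc.
have c_le : c <= y m.
  rewrite cE -[y m]mul1r -p1 mulr_suml; apply: ler_sum => -[i /= im] _.
  by apply: ler_wpM2l; [rewrite ltW // p_gt0 | exact: shooting_mono].
have -> : \sum_(i < m) (y i.+1 - y i) ^+ 2 * v i =
    - \sum_(i < m.+1) (y i - c) * (d i.+1 - d i).
  rewrite (sum_by_parts (fun i => y i - c)) dm (shooting_flux0 yd).
  rewrite !mulr0 subr0 sub0r opprK; apply: eq_bigr => i _.
  have vi := v_gt0 (ltn_ord i).
  rewrite (shooting_step yd) //; field; exact: lt0r_neq0.
have -> : t * \sum_(i < m.+1) p i * (y i - c) ^+ 2 =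
    \sum_(i < m.+1) t * (p i * y i * (y i - c)).
  rewrite -mulr_sumr; congr (_ * _).
  transitivity (\sum_(i < m.+1) (p i * y i * (y i - c)
      - (c * (p i * y i) - c ^+ 2 * p i))).
    by apply: eq_bigr => i _; ring.
  by rewrite sumrB sumrB -!mulr_sumr -cE p1; ring.
rewrite -sumrN; apply: ler_sum => -[i /= im] _.
(* Either the flux equation is exact at [i], or the flux has stopped there, in
   which case [y i = y m] is the maximum of [y] and is at least [c]. *)
have [di|di] := ltP 0 (d i.+1); first by rewrite (flux_eq im di); lra.
have dS := flux_eq0 im di.
have [_ yi] := @shooting_stop i m im (leqnn m) dS.
have := flux_ge im; rewrite dS; have : 0 <= y i - c by rewrite -yi subr_ge0.
by nra.
Qed.

End Shooting.

(** * The spectral gap of the path *)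

Section Path.
Context {R : realType} {m : nat} { pi : 'I_m.+1 -> R} {nu : 'I_m -> R}.

Lemma at1_ord (k : nat) (f : 'I_k -> R) (i : 'I_k) : at1 f i.+1 = f i.
Proof. by rewrite /at1 valK. Qed.

Lemma mean_at1 (f : 'I_m.+1 -> R) :
  mean pi f = \sum_(i < m.+1) at1 pi i.+1 * at1 f i.+1.
Proof. by apply: eq_bigr => i _; rewrite !at1_ord mulrC. Qed.

Lemma energy_at1 (f : 'I_m.+1 -> R) : energy (n := m.+1) nu f f =
  \sum_(i < m) (at1 f i.+2 - at1 f i.+1) ^+ 2 * at1 nu i.+1.
Proof.
by rewrite /energy big_add1 big_mkord; apply: eq_bigr => i _; ring.
Qed.

Hypothesis pi_gt0 : forall i, 0 < pi i.
Hypothesis pi_sum1 : \sum_(i < m.+1) pi i = 1.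
Hypothesis nu_gt0 : forall e, 0 < nu e.

Lemma variance_at1 (f : 'I_m.+1 -> R) : variance pi f =
  \sum_(i < m.+1) at1 pi i.+1 * (at1 f i.+1 - mean pi f) ^+ 2.
Proof.
rewrite varianceE // /mean; apply: eq_bigr => i _.
by rewrite !at1_ord mulrC.
Qed.

Let at1_pi_gt0 i : (i <= m)%N -> 0 < at1 pi i.+1.
Proof. by move=> im; rewrite (at1_ord pi (Ordinal (im : (i < m.+1)%N))). Qed.

Let at1_nu_gt0 i : (i < m)%N -> 0 < at1 nu i.+1.
Proof. by move=> im; rewrite (at1_ord nu (Ordinal im)). Qed.

Let at1_pi_sum1 : \sum_(i < m.+1) at1 pi i.+1 = 1.
Proof. by rewrite -pi_sum1; apply: eq_bigr => i _; rewrite at1_ord. Qed.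

Fixpoint psi_flux (a t : R) (k : nat) : R :=
  if k is i.+1 then
    Num.max (psi_flux a t i
             - t * at1 pi i.+1 * psi_at (n := m.+1) pi nu a t i.+1) 0
  else 0.

Lemma psi_shooting (a t : R) :
  shooting m (fun i => at1 pi i.+1) (fun i => at1 nu i.+1) a t
    (fun i => psi_at (n := m.+1) pi nu a t i.+1) (psi_flux a t).
Proof.
set y := psi_at (n := m.+1) pi nu a t.
have yS i : y i.+2 = y i.+1 + Num.max ((y i.+1 - y i) * at1 nu i
  - t * at1 pi i.+1 * y i.+1) 0 / at1 nu i.+1 by [].
have fluxE i : (i <= m)%N -> (y i.+1 - y i) * at1 nu i = psi_flux a t i.
  elim: i => [|i IH] im; first by rewrite mulr0.
  rewrite yS addrC addKr divfK ?gt_eqF ?at1_nu_gt0 //.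
  by rewrite IH // ltnW.
by split=> // i im; rewrite yS fluxE // ltnW.
Qed.

Context {a t : R}.
Hypothesis a_gt0 : 0 < a.
Let f : 'I_m.+1 -> R := psi (n := m.+1) pi nu a t.

Let psi_at1 i : (i <= m)%N -> at1 f i.+1 = psi_at (n := m.+1) pi nu a t i.+1.
Proof. by move=> im; rewrite (at1_ord f (Ordinal (im : (i < m.+1)%N))). Qed.

Let mean_psi : mean pi f =
  \sum_(i < m.+1) at1 pi i.+1 * psi_at (n := m.+1) pi nu a t i.+1.
Proof.
by rewrite mean_at1; apply: eq_bigr => -[i im] _; rewrite psi_at1.
Qed.

Hypothesis m_gt0 : (0 < m)%N.

Let gap_attained := @spectral_gap_min R m.+1 pi nu m_gt0 pi_gt0 pi_sum1.

Lemma spectral_gap_ge0 : 0 <= spectral_gap (n := m.+1) pi nu.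
Proof.
have [[g gnc <-] _] := gap_attained.
rewrite divr_ge0 ?(ltW (variance_gt0 pi_gt0 pi_sum1 gnc)) // energy_at1.
by apply: sumr_ge0 => i _; rewrite mulr_ge0 ?sqr_ge0 // ltW // at1_nu_gt0.
Qed.

Lemma le_spectral_gap : mean pi f <= 0 -> t <= spectral_gap (n := m.+1) pi nu.
Proof.
move=> mean0; have [t0|t0] := leP t 0.
  exact: le_trans t0 spectral_gap_ge0.
have [[g gnc <-] _] := gap_attained.
rewrite ler_pdivlMr ?variance_gt0 // energy_at1 variance_at1.
set c := mean pi g.
rewrite mean_psi in mean0.
have gc0 : \sum_(i < m.+1) at1 pi i.+1 * (at1 g i.+1 - c) = 0.
  under eq_bigr do rewrite mulrBr.
  by rewrite sumrB -mulr_suml at1_pi_sum1 mul1r -mean_at1 subrr.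
have le := poincare_of_shooting (psi_shooting a t) at1_pi_gt0 at1_nu_gt0
  a_gt0 t0 (f := fun i => at1 g i.+1 - c) mean0 gc0.
apply: (le_trans le); apply: ler_sum => i _.
by rewrite opprB addrA subrK.
Qed.

Lemma spectral_gap_le : 0 <= mean pi f -> spectral_gap (n := m.+1) pi nu <= t.
Proof.
have yd := psi_shooting a t.
move=> mean0; have [t0|t0] := leP t 0.
  move: mean0; rewrite mean_psi leNgt => /negP[].
  rewrite (eq_bigr (fun i : 'I_m.+1 => - a * at1 pi i.+1)); last first.
    move=> -[i im] _.
    by have [-> _] := shooting_nonpos yd at1_pi_gt0 a_gt0 t0 im; rewrite mulrC.
  by rewrite -mulr_sumr at1_pi_sum1 mulr1 oppr_lt0.
have fnc : nonconstant f.
  exists ord0, (Ordinal (m_gt0 : (1 < m.+1)%N)).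
  rewrite -(at1_ord f ord0) -(at1_ord f (Ordinal _)) !psi_at1 //.
  apply/eqP; rewrite lt_eqF // (shooting_step yd m_gt0) ltrDl divr_gt0 //.
    rewrite (shooting_fluxS yd) // (shooting_flux0 yd) (shooting_start yd).
    rewrite lt_max sub0r mulrN opprK.
    by rewrite !mulr_gt0 // at1_pi_gt0.
  exact: at1_nu_gt0.
have [_ /(_ (energy (n := m.+1) nu f f / variance pi f)) lb] := gap_attained.
apply: (le_trans (lb _)); first by exists f.
rewrite ler_pdivrMr ?variance_gt0 //.
rewrite energy_at1 variance_at1.
rewrite (eq_bigr (fun i : 'I_m => (psi_at (n := m.+1) pi nu a t i.+2
   - psi_at (n := m.+1) pi nu a t i.+1) ^+ 2 * at1 nu i.+1)); last first.
  by move=> -[i im] _; rewrite !psi_at1 // ltnW.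
rewrite (eq_bigr (fun i : 'I_m.+1 => at1 pi i.+1 *
   (psi_at (n := m.+1) pi nu a t i.+1 - mean pi f) ^+ 2)); last first.
  by move=> -[i im] _; rewrite !psi_at1.
exact: (energy_le_of_shooting yd at1_pi_gt0 at1_nu_gt0 a_gt0 t0 mean_psi).
Qed.

End Path.

(** * Bisection *)

Lemma bisection_bracket (R : realType) (n : nat) (pi : 'I_n -> R)
    (nu : 'I_n.-1 -> R) (a L0 U0 g : R) (k : nat) :
  (forall t, mean pi (psi pi nu a t) <= 0 -> t <= g) ->
  (forall t, 0 <= mean pi (psi pi nu a t) -> g <= t) ->
  L0 <= g <= U0 ->
  let L := lower pi nu a L0 U0 k in let U := upper pi nu a L0 U0 k in
  [/\ L <= g, g <= U & U - L <= (U0 - L0) * 2 ^- k].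
Proof.
move=> neg pos /andP[Lg gU]; rewrite /lower /upper /=.
elim: k => [|k] /=; first by rewrite expr0 invr1 mulr1.
case: (bisection _ _ _ _ _ k) => L U /= [{}Lg {}gU UL].
have -> : (U0 - L0) * 2 ^- k.+1 = (U0 - L0) * 2 ^- k / 2.
  by rewrite exprS invfM mulrAC mulrA.
have := neg ((L + U) / 2); have := pos ((L + U) / 2).
by case: ltgtP => _ /= P N; split; do ?[exact: P | exact: N]; lra.
Qed.

Unset Implicit Arguments.

Theorem theorem1p4 (R : realType) (n : nat) (pi : 'I_n -> R)
    (nu : 'I_n.-1 -> R) (a L0 U0 : R)
    (n_ge2 : (2 <= n)%N)
    (pi_gt0 : forall i, 0 < pi i) (pi_sum1 : \sum_(i < n) pi i = 1)
    (nu_gt0 : forall e, 0 < nu e)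
    (a_gt0 : 0 < a)
    (L0_lt : L0 < spectral_gap pi nu) (U0_gt : spectral_gap pi nu < U0) :
  forall k : nat,
    0 <= Num.max (upper pi nu a L0 U0 k - spectral_gap pi nu)
                 (spectral_gap pi nu - lower pi nu a L0 U0 k)
      <= (U0 - L0) * 2 ^- k.
Proof.
move=> k; set g := spectral_gap pi nu.
have [Lg gU UL] : let L := lower pi nu a L0 U0 k in
    let U := upper pi nu a L0 U0 k in
    [/\ L <= g, g <= U & U - L <= (U0 - L0) * 2 ^- k].
  apply: bisection_bracket; last by rewrite !ltW.
    rewrite /g; case: n pi nu n_ge2 pi_gt0 pi_sum1 nu_gt0 {g L0_lt U0_gt} => //.
    by move=> m pi nu m0 pi0 pi1 nu0 t; exact: le_spectral_gap.
  rewrite /g; case: n pi nu n_ge2 pi_gt0 pi_sum1 nu_gt0 {g L0_lt U0_gt} => //.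
  by move=> m pi nu m0 pi0 pi1 nu0 t; exact: spectral_gap_le.
by rewrite le_max ge_max subr_ge0 gU /=; apply/andP; split; lra.
Qed.
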